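(* In a Malcev dialgebra with operation $ab$, every polynomial identity of degree $5$ satisfied by the trilinear operation $$\langle a,b,c\rangle = 2(ab)c + a(bc) + (ac)b$$ is a consequence of the defining identities for Leibniz triple systems: $$\langle a,\langle b,c,d\rangle,e\rangle \equiv \langle\langle a,b,c\rangle,d,e\rangle - \langle\langle a,c,b\rangle,d,e\rangle - \langle\langle a,d,b\rangle,c,e\rangle + \langle\langle a,d,c\rangle,b,e\rangle,$$ $$\langle a,b,\langle c,d,e\rangle\rangle \equiv \langle\langle a,b,c\rangle,d,e\rangle - \langle\langle a,b,d\rangle,c,e\rangle - \langle\langle a,b,e\rangle,c,d\rangle + \langle\langle a,b,e\rangle,d,c\rangle.$$
   Context: Over a field of characteristic not $2$, a (right) Malcev dialgebra is a vector space with a bilinear operation $ab$ satisfying right anticommutativity $a(bc)+a(cb)\equiv 0$ and the di-Malcev identity $((ab)c)d - ((ad)b)c - (a(cd))b - (ac)(bd) - a((bc)d) \equiv 0$. A Leibniz triple system is a vector space with a trilinear operation $\langle -,-,-\rangle$ satisfying the two identities displayed in the claim. A polynomial identity of degree $5$ for a trilinear operation is a homogeneous element of degree $5$ (each monomial involving two applications of the operation) of the free algebra with one trilinear operation. The identities in question are those satisfied by the given trilinear operation in every Malcev dialgebra, that is, those vanishing for all values of the variables. An identity is a consequence of a set of identities if it lies in the ideal, closed under all endomorphisms, which they generate in the free algebra with one trilinear operation.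
   Formalization: The field is also assumed to have characteristic different from 3; in characteristic 3 the claim fails, since ⟨a,b,c⟩+⟨a,c,b⟩ vanishes in every Malcev dialgebra and yields a degree 5 identity that is not a consequence of the Leibniz triple system identities. *)

(* Defs.v *)
(* {malg R[K]} (multinomials) is the free R-module with basis K. *)
From HB Require Import structures.
From mathcomp Require Import all_boot all_algebra sesquilinear.
From mathcomp Require Import finmap monalg.
Set Implicit Arguments.
Unset Strict Implicit.
Unset Printing Implicit Defensive.
Import GRing.Theory.
Local Open Scope ring_scope.

(* The standing assumption on the characteristic of F is not part of the
   structure. *)
Record malcevDialgebra (F : fieldType) := MalcevDialgebra {
  md_carrier :> lmodType F;
  md_mul : {bilinear md_carrier -> md_carrier -> md_carrier};
  md_right_anticomm : forall a b c : md_carrier,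
    md_mul a (md_mul b c) + md_mul a (md_mul c b) = 0;
  md_di_malcev : forall a b c d : md_carrier,
    md_mul (md_mul (md_mul a b) c) d - md_mul (md_mul (md_mul a d) b) c
    - md_mul (md_mul a (md_mul c d)) b - md_mul (md_mul a c) (md_mul b d)
    - md_mul a (md_mul (md_mul b c) d) = 0
}.

Arguments md_mul {F m}.

(* <a, b, c> + <a, c, b> = 3 ((ab)c + (ac)b) vanishes in characteristic 3, which
   is why that characteristic has to be excluded along with 2. *)
Definition md_triple (F : fieldType) (D : malcevDialgebra F) (a b c : D) : D :=
  2%:R *: md_mul (md_mul a b) c + md_mul a (md_mul b c) + md_mul (md_mul a c) b.

(* Nonassociative monomials in one ternary operation symbol and the variables
   x_0, x_1, x_2, ...; they form the basis of the free trilinear algebra. *)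
Inductive tmono : Type :=
| TVar of nat
| TOp of tmono & tmono & tmono.

Fixpoint tmono_encode (m : tmono) : GenTree.tree nat :=
  match m with
  | TVar i => GenTree.Leaf i
  | TOp m1 m2 m3 =>
      GenTree.Node 0 [:: tmono_encode m1; tmono_encode m2; tmono_encode m3]
  end.

Fixpoint tmono_decode (t : GenTree.tree nat) : option tmono :=
  match t with
  | GenTree.Leaf i => Some (TVar i)
  | GenTree.Node _ [:: t1; t2; t3] =>
      match tmono_decode t1, tmono_decode t2, tmono_decode t3 with
      | Some m1, Some m2, Some m3 => Some (TOp m1 m2 m3)
      | _, _, _ => None
      end
  | _ => None
  end.

Lemma tmono_encodeK : pcancel tmono_encode tmono_decode.
Proof. by elim=> //= m1 -> m2 -> m3 ->. Qed.

HB.instance Definition _ := Countable.copy tmono (pcan_type tmono_encodeK).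

(* The degree counts variable occurrences: degree 5 means exactly two
   applications of the operation. *)
Fixpoint tmono_deg (m : tmono) : nat :=
  match m with
  | TVar _ => 1
  | TOp m1 m2 m3 => tmono_deg m1 + tmono_deg m2 + tmono_deg m3
  end.

Definition freeTri (F : fieldType) : lmodType F := {malg F[tmono]}.

Definition tvar (F : fieldType) (i : nat) : freeTri F := << TVar i >>.

Definition tprod (F : fieldType) (f g h : freeTri F) : freeTri F :=
  \sum_(m1 <- msupp f) \sum_(m2 <- msupp g) \sum_(m3 <- msupp h)
    << f@_m1 * g@_m2 * h@_m3 *g TOp m1 m2 m3 >>.

(* Not necessarily multilinear: variables may be repeated. *)
Definition thomog (F : fieldType) (n : nat) (f : freeTri F) : Prop :=
  {in msupp f, forall m, tmono_deg m = n}.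

Fixpoint tmono_eval (V : Type) (t : V -> V -> V -> V) (v : nat -> V)
    (m : tmono) : V :=
  match m with
  | TVar i => v i
  | TOp m1 m2 m3 => t (tmono_eval t v m1) (tmono_eval t v m2) (tmono_eval t v m3)
  end.

Definition teval (F : fieldType) (V : lmodType F) (t : V -> V -> V -> V)
    (v : nat -> V) (f : freeTri F) : V :=
  \sum_(m <- msupp f) f@_m *: tmono_eval t v m.

Definition satisfies_identity (F : fieldType) (V : lmodType F)
    (t : V -> V -> V -> V) (f : freeTri F) : Prop :=
  forall v : nat -> V, teval t v f = 0.

Record T_ideal (F : fieldType) (I : freeTri F -> Prop) : Prop := TIdeal {
  T_ideal0 : I 0;
  T_idealD : forall f g, I f -> I g -> I (f + g);
  T_idealZ : forall (c : F) f, I f -> I (c *: f);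
  T_ideal_op1 : forall f g h, I f -> I (tprod f g h);
  T_ideal_op2 : forall f g h, I g -> I (tprod f g h);
  T_ideal_op3 : forall f g h, I h -> I (tprod f g h);
  T_ideal_endo : forall phi : {linear freeTri F -> freeTri F},
    (forall f g h, phi (tprod f g h) = tprod (phi f) (phi g) (phi h)) ->
    forall f, I f -> I (phi f)
}.

Definition consequence (F : fieldType) (S : freeTri F -> Prop)
    (f : freeTri F) : Prop :=
  forall I : freeTri F -> Prop, T_ideal I -> (forall s, S s -> I s) -> I f.

(* Left-hand side minus right-hand side of the two identities defining Leibniz
   triple systems. *)
Definition lts_expr1 (V : zmodType) (t : V -> V -> V -> V) (a b c d e : V) : V :=
  t a (t b c d) e
  - (t (t a b c) d e - t (t a c b) d e - t (t a d b) c e + t (t a d c) b e).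

Definition lts_expr2 (V : zmodType) (t : V -> V -> V -> V) (a b c d e : V) : V :=
  t a b (t c d e)
  - (t (t a b c) d e - t (t a b d) c e - t (t a b e) c d + t (t a b e) d c).

Inductive LTS_identity (F : fieldType) : freeTri F -> Prop :=
| LTS_id1 : LTS_identity (lts_expr1 (@tprod F)
    (tvar F 0) (tvar F 1) (tvar F 2) (tvar F 3) (tvar F 4))
| LTS_id2 : LTS_identity (lts_expr2 (@tprod F)
    (tvar F 0) (tvar F 1) (tvar F 2) (tvar F 3) (tvar F 4)).

(* Main.v *)
(* In a Leibniz algebra, that is, when a(bc) = (ab)c - (ac)b, the di-Malcev
   identity holds and <a,b,c> = 3(ab)c.  Let A be the free associative algebra
   on x_0, x_1, ...; the Leibniz algebra A^- + A, with product
   (a, m)(b, n) = ([a, b], mb), sends <<x_i,x_j,x_k>,x_l,x_n>, evaluated at the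
   elements (x_i, x_i), to an element with second component 9 x_i x_j x_k x_l x_n.
   These words are independent, while the Leibniz triple system identities
   rewrite each monomial of degree 5 as a combination of the left-normed ones. *)
Require Import Defs.
From HB Require Import structures.
From mathcomp Require Import all_boot all_algebra sesquilinear finmap monalg.
From mathcomp Require Import zify.
Set Implicit Arguments.
Unset Strict Implicit.
Import GRing.Theory.
Local Open Scope ring_scope.

(** * Linear extension from the basis of a free module *)

Section LinearExtension.
Variables (F : fieldType) (K : choiceType) (V : lmodType F).
Implicit Types (h : K -> V) (f g : {malg F[K]}).

Definition lin_ext h f : V := \sum_(k <- msupp f) f@_k *: h k.

Lemma lin_extEw (d : {fset K}) h f : (msupp f `<=` d)%fset ->
  lin_ext h f = \sum_(k <- d) f@_k *: h k.
Proof.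
move=> le; apply: (big_fset_incl _ le) => k _ /mcoeff_outdom ->.
by rewrite scale0r.
Qed.

Lemma lin_ext_is_linear h : linear (lin_ext h).
Proof.
move=> c f g.
set d := (msupp f `|` msupp g)%fset.
have lef : (msupp f `<=` d)%fset by apply: fsubsetUl.
have leg : (msupp g `<=` d)%fset by apply: fsubsetUr.
have lefg : (msupp (c *: f + g) `<=` d)%fset.
  apply: fsubset_trans (msuppD_le _ _) _; rewrite fsubUset leg andbT.
  exact: fsubset_trans (msuppZ_le _ _) lef.
rewrite !(@lin_extEw d) // scaler_sumr -big_split /=; apply: eq_bigr => k _.
by rewrite mcoeffD mcoeffZ scalerDl scalerA.
Qed.

HB.instance Definition _ h :=
  GRing.isLinear.Build F {malg F[K]} V *:%R (lin_ext h) (lin_ext_is_linear h).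

Lemma lin_extU h (c : F) (k : K) : lin_ext h << c *g k >> = c *: h k.
Proof. by rewrite (lin_extEw _ msuppU_le) big_seq_fset1 mcoeffUU. Qed.

Lemma eq_lin_ext h1 h2 : h1 =1 h2 -> lin_ext h1 =1 lin_ext h2.
Proof. by move=> eq_h f; apply: eq_bigr => k _; rewrite eq_h. Qed.

End LinearExtension.

Lemma linear_lin_ext (F : fieldType) (K : choiceType) (V W : lmodType F)
    (phi : {linear V -> W}) (h : K -> V) (f : {malg F[K]}) :
  phi (lin_ext h f) = lin_ext (phi \o h) f.
Proof. by rewrite linear_sum; apply: eq_bigr => k _; rewrite linearZ. Qed.

(** * The free trilinear algebra and renaming of variables *)

Section FreeTriple.
Variable F : fieldType.
Implicit Types (f g h : freeTri F) (s : nat -> nat).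

(** Nested linear extensions exhibit trilinearity, so identities about [tprod] reduce to
    monomials. *)
Lemma tprod_lin_ext f g h :
  tprod f g h =
  lin_ext (fun m1 => lin_ext (fun m2 =>
    lin_ext (fun m3 => << TOp m1 m2 m3 >> : freeTri F) h) g) f.
Proof.
rewrite /tprod /lin_ext; apply: eq_bigr => m1 _.
rewrite scaler_sumr; apply: eq_bigr => m2 _.
rewrite !scaler_sumr; apply: eq_bigr => m3 _.
rewrite !scalerA; apply/malgP => k.
by rewrite mcoeffZ !mcoeffU mulrnAr mulr1.
Qed.

Lemma tprodU m1 m2 m3 :
  tprod (<< m1 >> : freeTri F) << m2 >> << m3 >> = << TOp m1 m2 m3 >>.
Proof. by rewrite tprod_lin_ext !lin_extU !scale1r. Qed.

Fixpoint tmono_rename s (m : tmono) : tmono :=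
  match m with
  | TVar i => TVar (s i)
  | TOp m1 m2 m3 =>
      TOp (tmono_rename s m1) (tmono_rename s m2) (tmono_rename s m3)
  end.

(** These endomorphisms carry the identities, stated in x_0, ..., x_4, to arbitrary variables; in
    degree 5 no other substitution is required. *)
Definition trename s : {linear freeTri F -> freeTri F} :=
  lin_ext (fun m => << tmono_rename s m >> : freeTri F).

Lemma trename_tprod s f g h :
  trename s (tprod f g h) = tprod (trename s f) (trename s g) (trename s h).
Proof.
rewrite !tprod_lin_ext !linear_lin_ext; apply: eq_lin_ext => m1 /=.
rewrite lin_extU scale1r !linear_lin_ext; apply: eq_lin_ext => m2 /=.
rewrite lin_extU scale1r !linear_lin_ext; apply: eq_lin_ext => m3 /=.
by rewrite !lin_extU !scale1r.
Qed.

Lemma trename_tvar s i : trename s (tvar F i) = tvar F (s i).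
Proof. by rewrite /= lin_extU scale1r. Qed.

End FreeTriple.

(** * Leibniz algebras as Malcev dialgebras *)

Lemma subrACA (V : zmodType) (a b c d : V) :
  (a - b) - (c - d) = (a - c) - (b - d).
Proof. by rewrite opprD addrACA -opprD. Qed.

Section LeibnizAlgebra.
Variables (F : fieldType) (L : lmodType F) (mul : {bilinear L -> L -> L}).
Hypothesis leibniz : forall a b c : L,
  mul a (mul b c) = mul (mul a b) c - mul (mul a c) b.

Lemma leibniz_right_anticomm (a b c : L) :
  mul a (mul b c) + mul a (mul c b) = 0.
Proof. by rewrite !leibniz -opprB addNr. Qed.

(** The Leibniz rule expands every product into left-normed ones, which cancel in pairs. *)
Lemma leibniz_di_malcev (a b c d : L) :
  mul (mul (mul a b) c) d - mul (mul (mul a d) b) c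
  - mul (mul a (mul c d)) b - mul (mul a c) (mul b d)
  - mul a (mul (mul b c) d) = 0.
Proof.
rewrite !leibniz !linearBl /=.
rewrite [X in _ - X]subrACA.
apply/eqP; rewrite subr_eq0 -addrA -opprD; apply/eqP; congr (_ - _).
by rewrite addrC subrKA.
Qed.

Definition leibniz_malcev : malcevDialgebra F :=
  MalcevDialgebra leibniz_right_anticomm leibniz_di_malcev.

Lemma md_triple_leibniz (a b c : leibniz_malcev) :
  md_triple a b c = 3%:R *: mul (mul a b) c.
Proof.
rewrite /md_triple /= leibniz -addrA subrK.
by rewrite [in RHS](natrD _ 2 1) [in RHS]scalerDl scale1r.
Qed.

End LeibnizAlgebra.

(** * The hemisemidirect product of an associative algebra with itself *)

Section Hemisemidirect.
Variables (F : fieldType) (A : algType F).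

Definition commr (x y : A) : A := x * y - y * x.

(** The Jacobi identity: on the right the words yxz and zxy cancel. *)
Lemma commr_leibniz x y z :
  commr x (commr y z) = commr (commr x y) z - commr (commr x z) y.
Proof.
rewrite /commr !mulrBl !mulrBr !mulrA.
set P := x * y * z; set Q := x * z * y; set R := y * z * x.
set S := z * y * x; set M := y * x * z; set N := z * x * y.
rewrite (opprB (Q - N)) addrACA subrKA -opprD.
by rewrite (addrC (N - S)) subrKA subrACA.
Qed.

(** The four words have the order and signs of the right-hand sides of the Leibniz triple system
    identities. *)
Lemma commr2E x y z :
  commr (commr x y) z = x * y * z - y * x * z - z * x * y + z * y * x.
Proof. by rewrite /commr !mulrBl !mulrBr !mulrA opprB addrA addrAC. Qed.

Definition hsmul (u v : A * A) : A * A := (commr u.1 v.1, u.2 * v.1).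

Lemma hsmul_is_bilinear :
  bilinear_for (GRing.Scale.Law.clone _ _ *:%R _)
    (GRing.Scale.Law.clone _ _ *:%R _) hsmul.
Proof.
split=> [w c u v | w c u v]; congr pair => /=; rewrite /commr.
- by rewrite mulrDl mulrDr -scalerAl -scalerAr scalerBr opprD addrACA.
- by rewrite mulrDl -scalerAl.
- by rewrite mulrDl mulrDr -scalerAl -scalerAr scalerBr opprD addrACA.
- by rewrite mulrDr -scalerAr.
Qed.

HB.instance Definition _ := bilinear_isBilinear.Build F
  (A * A)%type (A * A)%type (A * A)%type _ _ hsmul hsmul_is_bilinear.

(** In the second component: right multiplication turns commutators into commutators of
    operators. *)
Lemma hsmul_leibniz (a b c : A * A) :
  hsmul a (hsmul b c) = hsmul (hsmul a b) c - hsmul (hsmul a c) b.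
Proof.
congr pair => /=; first exact: commr_leibniz.
by rewrite mulrBr !mulrA.
Qed.

Definition hemisemidirect : malcevDialgebra F := leibniz_malcev hsmul_leibniz.

Definition hstriple (u v w : A * A) : A * A :=
  (3%:R *: commr (commr u.1 v.1) w.1, 3%:R *: (u.2 * v.1 * w.1)).

Lemma tmono_eval_hemisemidirect (v : nat -> A * A) m :
  tmono_eval (@md_triple F hemisemidirect) v m = tmono_eval hstriple v m.
Proof.
elim: m => //= m1 IH1 m2 IH2 m3 IH3.
by rewrite [LHS]md_triple_leibniz IH1 IH2 IH3.
Qed.

End Hemisemidirect.

(** * The shapes of monomials of degree 5 *)

Lemma tmono_deg_gt0 m : (0 < tmono_deg m)%N.
Proof. by elim: m => //= m1 IH1 m2 _ m3 _; rewrite -addnA addn_gt0 IH1. Qed.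

Lemma tmono_deg_le2 m : (tmono_deg m <= 2)%N -> exists i, m = TVar i.
Proof.
case: m => [i _|m1 m2 m3 /=]; first by exists i.
by move: (tmono_deg_gt0 m1) (tmono_deg_gt0 m2) (tmono_deg_gt0 m3); lia.
Qed.

Lemma tmono_deg3 m : tmono_deg m = 3 ->
  exists i j k, m = TOp (TVar i) (TVar j) (TVar k).
Proof.
case: m => [//|m1 m2 m3 /= d_m].
have := (tmono_deg_gt0 m1, tmono_deg_gt0 m2, tmono_deg_gt0 m3).
move=> [[gt1 gt2] gt3].
have [i ->] : exists i, m1 = TVar i by apply: tmono_deg_le2; lia.
have [j ->] : exists j, m2 = TVar j by apply: tmono_deg_le2; lia.
have [k ->] : exists k, m3 = TVar k by apply: tmono_deg_le2; lia.
by exists i, j, k.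
Qed.

Lemma tmono_deg_odd m : odd (tmono_deg m).
Proof.
by elim: m => //= m1 odd1 m2 odd2 m3 odd3; rewrite !oddD odd1 odd2 odd3.
Qed.

Variant tmono_deg5_spec : tmono -> Prop :=
| Deg5Left i j k l n :
    tmono_deg5_spec (TOp (TOp (TVar i) (TVar j) (TVar k)) (TVar l) (TVar n))
| Deg5Mid i j k l n :
    tmono_deg5_spec (TOp (TVar i) (TOp (TVar j) (TVar k) (TVar l)) (TVar n))
| Deg5Right i j k l n :
    tmono_deg5_spec (TOp (TVar i) (TVar j) (TOp (TVar k) (TVar l) (TVar n))).

Lemma tmono_deg5P m : tmono_deg m = 5 -> tmono_deg5_spec m.
Proof.
case: m => [//|m1 m2 m3 /= d_m].
have := (tmono_deg_gt0 m1, tmono_deg_gt0 m2, tmono_deg_gt0 m3).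
move=> [[gt1 gt2] gt3].
have := (tmono_deg_odd m1, tmono_deg_odd m2, tmono_deg_odd m3).
move=> [[odd1 odd2] odd3].
(* Three odd positive degrees with sum 5 are 3, 1, 1 in some order. *)
have [d3|[d3|d3]] : tmono_deg m1 = 3 \/ tmono_deg m2 = 3 \/ tmono_deg m3 = 3.
- by lia.
- have [i [j [k ->]]] := tmono_deg3 d3.
  have [l ->] : exists l, m2 = TVar l by apply: tmono_deg_le2; lia.
  have [n ->] : exists n, m3 = TVar n by apply: tmono_deg_le2; lia.
  exact: Deg5Left.
- have [j [k [l ->]]] := tmono_deg3 d3.
  have [i ->] : exists i, m1 = TVar i by apply: tmono_deg_le2; lia.
  have [n ->] : exists n, m3 = TVar n by apply: tmono_deg_le2; lia.
  exact: Deg5Mid.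
- have [k [l [n ->]]] := tmono_deg3 d3.
  have [i ->] : exists i, m1 = TVar i by apply: tmono_deg_le2; lia.
  have [j ->] : exists j, m2 = TVar j by apply: tmono_deg_le2; lia.
  exact: Deg5Right.
Qed.

(** * Leibniz triple system expressions under morphisms *)

Section TripleMorphism.
Variables (F : fieldType) (U V : lmodType F) (phi : {linear U -> V}).
Variables (t : U -> U -> U -> U) (t' : V -> V -> V -> V).
Hypothesis phi_t : forall a b c, phi (t a b c) = t' (phi a) (phi b) (phi c).

Lemma lts_expr1_morph a b c d e :
  phi (lts_expr1 t a b c d e) =
  lts_expr1 t' (phi a) (phi b) (phi c) (phi d) (phi e).
Proof. by rewrite /lts_expr1 !(linearD, linearN) !phi_t. Qed.

Lemma lts_expr2_morph a b c d e :
  phi (lts_expr2 t a b c d e) =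
  lts_expr2 t' (phi a) (phi b) (phi c) (phi d) (phi e).
Proof. by rewrite /lts_expr2 !(linearD, linearN) !phi_t. Qed.

End TripleMorphism.

Definition left_normed (F : fieldType) (i j k l n : nat) : freeTri F :=
  << TOp (TOp (TVar i) (TVar j) (TVar k)) (TVar l) (TVar n) >>.

(** * Reduction to left-normed monomials modulo a T-ideal *)

Section Reduction.
Variables (F : fieldType) (I : freeTri F -> Prop).
Hypothesis T_I : T_ideal I.
Hypothesis LTS_I : forall s, LTS_identity s -> I s.
Local Notation lnmono := (left_normed F).

Lemma T_ideal_sum (J : eqType) (r : seq J) (E : J -> freeTri F) :
  {in r, forall j, I (E j)} -> I (\sum_(j <- r) E j).
Proof.
move=> I_E; rewrite big_seq; elim/big_ind: _ => //; first exact: T_ideal0 T_I.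
exact: T_idealD T_I.
Qed.

Lemma lts1_monomial i j k l n :
  I (<< TOp (TVar i) (TOp (TVar j) (TVar k) (TVar l)) (TVar n) >>
     - (lnmono i j k l n - lnmono i k j l n - lnmono i l j k n
        + lnmono i l k j n)).
Proof.
(* The default 0 only affects variables beyond x_4, which do not occur. *)
have := T_ideal_endo T_I (trename_tprod (nth 0%N [:: i; j; k; l; n]))
  (LTS_I (LTS_id1 F)).
rewrite (lts_expr1_morph (trename_tprod _)) !trename_tvar.
by rewrite /lts_expr1 /tvar !tprodU.
Qed.

Lemma lts2_monomial i j k l n :
  I (<< TOp (TVar i) (TVar j) (TOp (TVar k) (TVar l) (TVar n)) >>
     - (lnmono i j k l n - lnmono i j l k n - lnmono i j n k l
        + lnmono i j n l k)).
Proof.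
have := T_ideal_endo T_I (trename_tprod (nth 0%N [:: i; j; k; l; n]))
  (LTS_I (LTS_id2 F)).
rewrite (lts_expr2_morph (trename_tprod _)) !trename_tvar.
by rewrite /lts_expr2 /tvar !tprodU.
Qed.

(** A linear [T] reading words back as left-normed monomials expresses the independence of these
    words. *)
Variables (A : algType F) (X : nat -> A) (T : {linear A -> freeTri F}).
Hypothesis T_word : forall i j k l n,
  T (X i * X j * X k * X l * X n) = lnmono i j k l n.

Let generic (i : nat) : A * A := (X i, X i).

(** A product nested in the first slot enters through its second component, a word; in another slot
    it enters through its first, a double commutator. The difference is then 0, or 9 times an
    instance of a Leibniz triple system identity. *)
Lemma monomial_sub_left_normed m : tmono_deg m = 5 ->
  I ((3 * 3)%:R *: << m >> - T (tmono_eval (@hstriple F A) generic m).2).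
Proof.
case/tmono_deg5P => i j k l n; rewrite /=.
- rewrite -!scalerAl scalerA -natrM linearZ /= T_word subrr.
  exact: T_ideal0 T_I.
- rewrite -scalerAr -scalerAl scalerA -natrM linearZ /= -scalerBr.
  apply: (T_idealZ T_I).
  rewrite commr2E !(mulrDr, mulrDl, mulrN, mulNr) !mulrA.
  rewrite !(linearD T) !(linearN T) !T_word; exact: lts1_monomial.
- rewrite -scalerAr scalerA -natrM linearZ /= -scalerBr.
  apply: (T_idealZ T_I).
  rewrite commr2E !(mulrDr, mulrN) !mulrA.
  rewrite !(linearD T) !(linearN T) !T_word; exact: lts2_monomial.
Qed.

Lemma hemisemidirect_identity (f : freeTri F) :
  3%N \notin [pchar F] -> thomog 5 f ->
  satisfies_identity (@md_triple F (hemisemidirect A)) f -> I f.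
Proof.
move=> char_neq3 hom_f sat_f.
have nz3 : 3%:R != 0 :> F by move: char_neq3; rewrite inE.
(* Each of the two applications of the operation contributes a factor 3. *)
have nz9 : (3 * 3)%:R != 0 :> F by rewrite natrM mulf_neq0.
pose E m := (tmono_eval (@hstriple F A) generic m).2.
(* Evaluate [f] at the generic elements and apply [T] to the second component. *)
have T_E0 : \sum_(m <- msupp f) f@_m *: T (E m) = 0.
  have /(congr1 snd) := sat_f generic.
  rewrite /teval (raddf_sum snd) => /(congr1 T).
  rewrite linear0 linear_sum; apply: etrans; apply: eq_bigr => m _.
  by rewrite tmono_eval_hemisemidirect linearZ.
(* Subtracting this vanishing sum makes every summand an element of [I]. *)
have f9 : (3 * 3)%:R *: f =
    \sum_(m <- msupp f) f@_m *: ((3 * 3)%:R *: << m >> - T (E m)).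
  under eq_bigr do rewrite scalerBr.
  rewrite sumrB T_E0 subr0 {1}[f]monalgE scaler_sumr.
  apply: eq_bigr => m _; rewrite scalerA mulrC -scalerA; congr (_ *: _).
  by apply/malgP => k; rewrite mcoeffZ !mcoeffU mulrnAr mulr1.
rewrite -[f](scalerK nz9) f9.
apply: (T_idealZ T_I); apply: T_ideal_sum => m m_f.
apply: (T_idealZ T_I); apply: monomial_sub_left_normed.
exact: hom_f.
Qed.

End Reduction.

(** * The free associative algebra and its words *)

Lemma malg_scalerAr (R : comNzRingType) (K : monomType) (c : R)
    (g1 g2 : {malg R[K]}) :
  c *: (g1 * g2) = g1 * (c *: g2).
Proof.
have malgC_central : c%:MP * g1 = g1 * c%:MP.
  rewrite !malgM_def fgmulUg fgmulgU; apply: eq_bigr => k _.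
  by rewrite mul1m mulm1 mulrC.
by rewrite -!mul_malgC !mulrA malgC_central.
Qed.

(* An alias, since the algebra instance on malg is taken by the commutative
   case. *)
Definition freeAssoc (R : comNzRingType) (I : choiceType) : Type :=
  {malg R[{fmonom I}]}.

HB.instance Definition _ (R : comNzRingType) (I : choiceType) :=
  GRing.Lalgebra.copy (freeAssoc R I) {malg R[{fmonom I}]}.
HB.instance Definition _ (R : comNzRingType) (I : choiceType) :=
  GRing.Lalgebra_isAlgebra.Build R (freeAssoc R I)
    (@malg_scalerAr R {fmonom I}).

Section FreeAssociative.
Variable F : fieldType.

Definition word (s : seq nat) : freeAssoc F nat := << FMonom s >>.

Lemma wordM s1 s2 : word s1 * word s2 = word (s1 ++ s2).
Proof. by rewrite malgM_def fgmulUU mulr1 [mmul _ _]fmmulE. Qed.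

(** Words of length other than 5 are sent to 0. *)
Definition left_normed_of_word (w : {fmonom nat}) : freeTri F :=
  if fmonom_val w is [:: i; j; k; l; n] then left_normed F i j k l n else 0.

Lemma left_normed_of_wordE i j k l n :
  lin_ext left_normed_of_word
    (word [:: i] * word [:: j] * word [:: k] * word [:: l] * word [:: n]) =
  left_normed F i j k l n.
Proof. by rewrite 4!wordM lin_extU scale1r. Qed.

End FreeAssociative.

Theorem theorem20 (F : fieldType) (char_neq2 : 2%N \notin [pchar F])
    (char_neq3 : 3%N \notin [pchar F]) (f : freeTri F) (hom_f : thomog 5 f)
    (sat_f : forall D : malcevDialgebra F,
               satisfies_identity (@md_triple F D) f) :
  consequence (@LTS_identity F) f.
Proof.
move=> I T_I LTS_I.
(* The free generators serve as [X]; since words form a basis, [T] can be prescribed on them. *)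
pose X i : freeAssoc F nat := word F [:: i].
pose T : {linear freeAssoc F nat -> freeTri F} :=
  lin_ext (@left_normed_of_word F).
apply: (@hemisemidirect_identity _ _ T_I LTS_I _ X T) => // i j k l n.
exact: left_normed_of_wordE.
Qed.
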